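(* Let $b_1 = y+x\bigl(xz+y(yu+z^2)\bigr)\in\mathbb{C}[x][y,z,u]$. There is no automorphism $\phi \in \mathrm{GA}_3(\mathbb{C}[x]) \cap \tilde{\psi}^*(\mathrm{GA}_3(\mathbb{C}[x]))$ with $\phi(y)=b_1$.
   Context: For a commutative ring $A$ with one, $\mathrm{GA}_n(A)$ is the group of automorphisms over $\operatorname{Spec} A$ of affine space $\operatorname{Spec} A^{[n]}$, where $A^{[n]}$ is the polynomial ring in $n$ variables over $A$. An element $\phi=(F_1,\ldots,F_n)$ is written as the tuple of its component polynomials, it acts on polynomials by substitution, $\phi(P)=P(F_1,\ldots,F_n)$, and composition is composition of polynomial maps, so $(\phi\circ\chi)(P)=\chi(\phi(P))$. The three variables over $\mathbb{C}[x]$ are $y,z,u$, and $\mathrm{GA}_3(\mathbb{C}[x])$ is regarded as a subgroup of $\mathrm{GA}_3(\mathbb{C}[x,x^{-1}])$. Set $p=yu+z^2$, $v=xz+yp$, $w=x^2u-2xzp-yp^2$. Then $\tilde\psi:=(y,v,w)$ is an element of $\mathrm{GA}_3(\mathbb{C}[x,x^{-1}])$. For $\alpha\in\mathrm{GA}_n(\mathbb{C}[x,x^{-1}])$, define $\alpha^*(\mathrm{GA}_n(\mathbb{C}[x]))=\{\alpha^{-1}\circ\phi\circ\alpha \mid \phi\in\mathrm{GA}_n(\mathbb{C}[x])\}\subset\mathrm{GA}_n(\mathbb{C}[x,x^{-1}])$. *)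

(* Defs.v *)
From HB Require Import structures.
From mathcomp Require Import all_boot all_order all_algebra.
From mathcomp Require Import complex.
From mathcomp Require Import boolp classical_sets reals.
From mathcomp Require Import mpoly ring.

Set Implicit Arguments.
Unset Strict Implicit.
Unset Printing Implicit Defensive.

Import GRing.Theory.
Local Open Scope classical_set_scope.
Local Open Scope ring_scope.

Section CompMpoly.
Variables (n : nat) (A : comNzRingType).
Implicit Types (F G H : n.-tuple {mpoly A[n]}) (p : {mpoly A[n]}).

Definition idtuple : n.-tuple {mpoly A[n]} := [tuple 'X_i | i < n].

(* (F_1, ..., F_n) o (G_1, ..., G_n) = (F_1(G), ..., F_n(G)) *)
Definition comptuple F G : n.-tuple {mpoly A[n]} :=
  [tuple tnth F i \mPo G | i < n].

Lemma comp_comptuple p F G : p \mPo comptuple F G = (p \mPo F) \mPo G.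
Proof.
rewrite comp_mpolyE [p \mPo F]comp_mpolyE raddf_sum /=.
apply: eq_bigr => m _; rewrite comp_mpolyZ rmorph_prod /=; congr (_ *: _).
by apply: eq_bigr => i _; rewrite rmorphXn /= tnth_mktuple.
Qed.

Lemma comptupleA : associative comptuple.
Proof.
by move=> F G H; apply: eq_from_tnth => i; rewrite !tnth_mktuple comp_comptuple.
Qed.

Lemma comptuple1F F : comptuple idtuple F = F.
Proof.
by apply: eq_from_tnth => i; rewrite !tnth_mktuple comp_mpolyXU -tnth_nth.
Qed.

Lemma comptupleF1 F : comptuple F idtuple = F.
Proof. by apply: eq_from_tnth => i; rewrite !tnth_mktuple comp_mpoly_id. Qed.

Definition inverse_pair (FG : n.-tuple {mpoly A[n]} * n.-tuple {mpoly A[n]}) :=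
  (comptuple FG.1 FG.2 == idtuple) && (comptuple FG.2 FG.1 == idtuple).

End CompMpoly.
Arguments idtuple {n A}.

(* GA_n(A). An element carries its inverse tuple along; that tuple is determined
   by the components (lemma GA_inj), so equality is equality of components. *)
Record GA (n : nat) (A : comNzRingType) := MkGA {
  ga_pair : n.-tuple {mpoly A[n]} * n.-tuple {mpoly A[n]} ;
  _ : inverse_pair ga_pair }.

HB.instance Definition _ n A := [isSub for @ga_pair n A].
HB.instance Definition _ n A := [Choice of GA n A by <:].

Section GAGroup.
Variables (n : nat) (A : comNzRingType).
Implicit Types phi chi : GA n A.

Definition ga_tuple phi : n.-tuple {mpoly A[n]} := (ga_pair phi).1.

Definition ga_act phi (P : {mpoly A[n]}) : {mpoly A[n]} := P \mPo ga_tuple phi.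

Lemma ga_pairP phi :
  comptuple (ga_pair phi).1 (ga_pair phi).2 = idtuple /\
  comptuple (ga_pair phi).2 (ga_pair phi).1 = idtuple.
Proof. by case: phi => FG /= /andP[/eqP ? /eqP ?]. Qed.

Lemma GA_inj : injective ga_tuple.
Proof.
move=> phi chi; rewrite /ga_tuple => e1; apply: val_inj => /=.
have [p12 p21] := ga_pairP phi; have [c12 c21] := ga_pairP chi.
suff e2 : (ga_pair phi).2 = (ga_pair chi).2.
  by case: (ga_pair phi) (ga_pair chi) e1 e2 => ? ? [? ?] /= -> ->.
by rewrite -[LHS]comptupleF1 -c12 -e1 comptupleA p21 comptuple1F.
Qed.

Fact ga_one_subproof : inverse_pair (@idtuple n A, @idtuple n A).
Proof. by rewrite /inverse_pair /= comptuple1F eqxx. Qed.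
Definition ga_one := MkGA ga_one_subproof.

Fact ga_inv_subproof phi : inverse_pair ((ga_pair phi).2, (ga_pair phi).1).
Proof.
by have [e1 e2] := ga_pairP phi; rewrite /inverse_pair /= e1 e2 eqxx.
Qed.
Definition ga_inv phi := MkGA (ga_inv_subproof phi).

Fact ga_mul_subproof phi chi :
  inverse_pair (comptuple (ga_pair phi).1 (ga_pair chi).1,
                comptuple (ga_pair chi).2 (ga_pair phi).2).
Proof.
have [p12 p21] := ga_pairP phi; have [c12 c21] := ga_pairP chi.
apply/andP; split; apply/eqP => /=.
  by rewrite -comptupleA [X in comptuple _ X]comptupleA c12 comptuple1F.
by rewrite -comptupleA [X in comptuple _ X]comptupleA p21 comptuple1F.
Qed.
Definition ga_mul phi chi := MkGA (ga_mul_subproof phi chi).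

Fact ga_mulA : associative ga_mul.
Proof. by move=> f g h; apply: GA_inj; rewrite /ga_tuple /= comptupleA. Qed.
Fact ga_mul1 : left_id ga_one ga_mul.
Proof. by move=> f; apply: GA_inj; rewrite /ga_tuple /= comptuple1F. Qed.
Fact ga_mulr1 : right_id ga_one ga_mul.
Proof. by move=> f; apply: GA_inj; rewrite /ga_tuple /= comptupleF1. Qed.
Fact ga_mulV : left_inverse ga_one ga_inv ga_mul.
Proof. by move=> f; apply: GA_inj; have [] := ga_pairP f. Qed.
Fact ga_mulrV : right_inverse ga_one ga_inv ga_mul.
Proof. by move=> f; apply: GA_inj; have [] := ga_pairP f. Qed.

HB.instance Definition _ :=
  isGroup.Build (GA n A) ga_mulA ga_mul1 ga_mulr1 ga_mulV ga_mulrV.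

Lemma ga_actM phi chi P : ga_act (phi * chi)%g P = ga_act chi (ga_act phi P).
Proof. exact: comp_comptuple. Qed.

End GAGroup.

Section GAMap.
Variables (n : nat) (A B : comNzRingType) (f : {rmorphism A -> B}).

Definition map_tuple_mpoly (F : n.-tuple {mpoly A[n]}) : n.-tuple {mpoly B[n]} :=
  [tuple map_mpoly f (tnth F i) | i < n].

Lemma map_mpoly_mPo (p : {mpoly A[n]}) (F : n.-tuple {mpoly A[n]}) :
  map_mpoly f (p \mPo F) = map_mpoly f p \mPo map_tuple_mpoly F.
Proof.
rewrite [in RHS](mpolyE p) comp_mpolyE.
rewrite (raddf_sum (map_mpoly f)) (raddf_sum (map_mpoly f)) raddf_sum /=.
apply: eq_bigr => m _; rewrite !map_mpolyZ comp_mpolyZ map_mpolyX comp_mpolyX.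
rewrite rmorph_prod /=; congr (_ *: _).
by apply: eq_bigr => i _; rewrite rmorphXn /= tnth_mktuple.
Qed.

Lemma map_tuple_comp F G :
  map_tuple_mpoly (comptuple F G) =
  comptuple (map_tuple_mpoly F) (map_tuple_mpoly G).
Proof.
by apply: eq_from_tnth => i; rewrite !tnth_mktuple map_mpoly_mPo.
Qed.

Lemma map_tuple_id : map_tuple_mpoly idtuple = idtuple.
Proof. by apply: eq_from_tnth => i; rewrite !tnth_mktuple map_mpolyX. Qed.

Fact ga_map_subproof (phi : GA n A) :
  inverse_pair (map_tuple_mpoly (ga_pair phi).1,
                map_tuple_mpoly (ga_pair phi).2).
Proof.
have [e1 e2] := ga_pairP phi.
by rewrite /inverse_pair /= -!map_tuple_comp e1 e2 map_tuple_id eqxx.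
Qed.
Definition ga_map (phi : GA n A) : GA n B := MkGA (ga_map_subproof phi).

End GAMap.

(* F[x, x^-1], as the subring of F(x) of the fractions p / x^k. *)
Section Laurent.
Variable F : fieldType.

Definition laurent_pred : {pred {fraction {poly F}}} :=
  fun f => `[< exists (p : {poly F}) (k : nat), f = tofrac p / tofrac 'X ^+ k >].

Record laurent := MkLaurent {
  laurent_val : {fraction {poly F}} ;
  _ : laurent_val \in laurent_pred }.

HB.instance Definition _ := [isSub for laurent_val].
HB.instance Definition _ := [Choice of laurent by <:].

Lemma tofracX_neq0 : tofrac ('X : {poly F}) != 0.
Proof. by rewrite tofrac_eq0 polyX_eq0. Qed.

Lemma laurent_predP f :
  reflect (exists (p : {poly F}) (k : nat), f = tofrac p / tofrac 'X ^+ k)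
          (f \in laurent_pred).
Proof. exact: asboolP. Qed.

Fact laurent_subring : subring_closed laurent_pred.
Proof.
have nz k : tofrac ('X : {poly F}) ^+ k != 0 by rewrite expf_neq0 ?tofracX_neq0.
split.
- by apply/laurent_predP; exists 1, 0%N; rewrite tofrac1 expr0 divr1.
- move=> f g /laurent_predP[p [k ->]] /laurent_predP[q [l ->]].
  apply/laurent_predP; exists (p * 'X^l - q * 'X^k), (k + l)%N.
  by rewrite exprD tofracB !tofracM !tofracXn -mulNr addf_div // mulNr.
- move=> f g /laurent_predP[p [k ->]] /laurent_predP[q [l ->]].
  apply/laurent_predP; exists (p * q), (k + l)%N.
  by rewrite exprD tofracM mulf_div.
Qed.
HB.instance Definition _ :=
  GRing.isSubringClosed.Build _ laurent_pred laurent_subring.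
HB.instance Definition _ := [SubChoice_isSubComNzRing of laurent by <:].

Fact poly_laurent_subproof (p : {poly F}) : tofrac p \in laurent_pred.
Proof. by apply/laurent_predP; exists p, 0%N; rewrite expr0 divr1. Qed.
Definition poly_laurent (p : {poly F}) : laurent :=
  MkLaurent (poly_laurent_subproof p).

Fact poly_laurent_zmod : zmod_morphism poly_laurent.
Proof. by move=> p q; apply: val_inj; rewrite raddfB /= tofracB. Qed.
HB.instance Definition _ :=
  GRing.isZmodMorphism.Build {poly F} laurent poly_laurent poly_laurent_zmod.

Fact poly_laurent_monoid : monoid_morphism poly_laurent.
Proof.
split; first by apply: val_inj; rewrite rmorph1 /= tofrac1.
by move=> p q; apply: val_inj; rewrite rmorphM /= tofracM.
Qed.
HB.instance Definition _ :=
  GRing.isMonoidMorphism.Build {poly F} laurent poly_laurent poly_laurent_monoid.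

Definition laurent_x : laurent := poly_laurent 'X.

Fact laurent_xV_subproof : (tofrac ('X : {poly F}))^-1 \in laurent_pred.
Proof. by apply/laurent_predP; exists 1, 1%N; rewrite tofrac1 div1r. Qed.
Definition laurent_xV : laurent := MkLaurent laurent_xV_subproof.

Lemma laurent_xK : laurent_x * laurent_xV = 1.
Proof. by apply: val_inj; rewrite rmorphM rmorph1 /= mulfV ?tofracX_neq0. Qed.

(* GA_n(F[x]) regarded as a subgroup of GA_n(F[x, x^-1]) *)
Definition GApoly (n : nat) : set (GA n laurent) :=
  [set ga_map poly_laurent phi | phi in [set: GA n {poly F}]].
Arguments GApoly n : clear implicits.

(* alpha^*(GA_n(F[x])) *)
Definition pullbackGApoly (n : nat) (alpha : GA n laurent) : set (GA n laurent) :=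
  [set (alpha^-1 * phi * alpha)%g | phi in GApoly n].

End Laurent.
Arguments GApoly F n : clear implicits.

(* x is the constant a of the base ring; the variables of A[y, z, u] are y, z, u. *)
Section Polynomials.
Variables (A : comNzRingType) (a : A).

Definition var_y : {mpoly A[3]} := 'X_(inord 0).
Definition var_z : {mpoly A[3]} := 'X_(inord 1).
Definition var_u : {mpoly A[3]} := 'X_(inord 2).
Local Notation x := (a%:MP_[3]).
Local Notation y := var_y.
Local Notation z := var_z.
Local Notation u := var_u.

Definition poly_p := y * u + z ^+ 2.
Definition poly_v := x * z + y * poly_p.
Definition poly_w := x ^+ 2 * u - 2 * x * z * poly_p - y * poly_p ^+ 2.

Definition poly_b1 := y + x * (x * z + y * (y * u + z ^+ 2)).

End Polynomials.
Arguments var_y {A}.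
Arguments var_z {A}.
Arguments var_u {A}.
Arguments poly_p {A}.

Section Psi.
Variable F : fieldType.
Local Notation L := (laurent F).
Local Notation t := ((laurent_xV F)%:MP_[3] : {mpoly L[3]}).
Local Notation x := (laurent_x F).

(* Since y w + v^2 = x^2 p, the inverse is obtained by solving for z and u
   with x^-2 (y u + z^2) in the role of p. *)
Definition psi_tuple : 3.-tuple {mpoly L[3]} :=
  [tuple var_y; poly_v x; poly_w x].
Definition psi_inv_tuple : 3.-tuple {mpoly L[3]} :=
  let q := t ^+ 2 * poly_p in
  [tuple var_y; t * (var_z - var_y * q);
         t ^+ 2 * (var_u + 2 * var_z * q - var_y * q ^+ 2)].

Section PsiIdentities.
Variables (A : comNzRingType) (a b y z v p q : A).
Hypothesis ab : a * b = 1.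

Fact psi_identity1 u : q = b ^+ 2 * (y * u + z ^+ 2) ->
  y * (b ^+ 2 * (u + 2 * z * q - y * q ^+ 2)) + (b * (z - y * q)) ^+ 2 = q.
Proof. by move=> ->; ring. Qed.

Fact psi_identity2 : a * (b * (z - y * q)) + y * q = z.
Proof. by rewrite mulrA ab mul1r subrK. Qed.

Fact psi_identity3 u : a ^+ 2 * (b ^+ 2 * (u + 2 * z * q - y * q ^+ 2))
  - 2 * a * (b * (z - y * q)) * q - y * q ^+ 2 = u.
Proof.
transitivity ((a * b) ^+ 2 * (u + 2 * z * q - y * q ^+ 2)
              - 2 * (a * b) * (z - y * q) * q - y * q ^+ 2); first by ring.
by rewrite ab; ring.
Qed.

Fact psi_identity4 u : p = y * u + z ^+ 2 -> v = a * z + y * p ->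
  b ^+ 2 * (y * (a ^+ 2 * u - 2 * a * z * p - y * p ^+ 2) + v ^+ 2) = p.
Proof.
move=> pE ->; transitivity ((a * b) ^+ 2 * p); last by rewrite ab expr1n mul1r.
by rewrite pE; ring.
Qed.

Fact psi_identity5 : b * (a * z + y * p - y * p) = z.
Proof. by rewrite addrK mulrCA mulrA ab mul1r. Qed.

Fact psi_identity6 u : v = a * z + y * p ->
  b ^+ 2 * (a ^+ 2 * u - 2 * a * z * p - y * p ^+ 2 + 2 * v * p - y * p ^+ 2)
  = u.
Proof.
move=> ->; transitivity ((a * b) ^+ 2 * u); last by rewrite ab expr1n mul1r.
by ring.
Qed.

End PsiIdentities.

Fact psi_subproof : inverse_pair (psi_tuple, psi_inv_tuple).
Proof.
have xt : (x%:MP_[3] : {mpoly L[3]}) * t = 1 by rewrite -mpolyCM laurent_xK.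
have tn3 (a b c : {mpoly L[3]}) (T := [tuple a; b; c]) :
  [/\ tnth T (inord 0) = a, tnth T (inord 1) = b & tnth T (inord 2) = c].
  by rewrite !(tnth_nth 0) /= !inordK.
have act (a b c : {mpoly L[3]}) (T := [tuple a; b; c]) :
  [/\ var_y \mPo T = a, var_z \mPo T = b & var_u \mPo T = c].
  by rewrite /var_y /var_z /var_u !comp_mpolyXU -!tnth_nth; apply: tn3.
have ext (G : 3.-tuple {mpoly L[3]}) : tnth G (inord 0) = var_y ->
   tnth G (inord 1) = var_z -> tnth G (inord 2) = var_u -> G = idtuple.
  move=> h0 h1 h2; apply: eq_from_tnth => i; rewrite tnth_mktuple.
  have -> : i = inord i by rewrite inord_val.
  by case: i => [[|[|[|]]]].
have morE := (rmorphD, rmorphN, rmorphM, rmorphXn, rmorph1).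
have [p0 p1 p2] := tn3 var_y (poly_v x) (poly_w x).
have [Y1 Z1 U1] := act var_y (poly_v x) (poly_w x).
rewrite -/psi_tuple in p0 p1 p2 Y1 Z1 U1.
set q : {mpoly L[3]} := t ^+ 2 * poly_p.
set zi : {mpoly L[3]} := t * (var_z - var_y * q).
set ui : {mpoly L[3]} := t ^+ 2 * (var_u + 2 * var_z * q - var_y * q ^+ 2).
have [q0 q1 q2] := tn3 var_y zi ui; have [Y2 Z2 U2] := act var_y zi ui.
have psiE : psi_inv_tuple = [tuple var_y; zi; ui] by [].
rewrite -psiE in q0 q1 q2 Y2 Z2 U2.
have C c G : (c%:MP_[3] : {mpoly L[3]}) \mPo G = c%:MP_[3].
  exact: comp_mpolyC.
have P2 : poly_p \mPo psi_inv_tuple = q.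
  by rewrite [in LHS]/poly_p !morE /= Y2 Z2 U2 -?expr2; apply: psi_identity1.
have Q1 : q \mPo psi_tuple = poly_p.
  rewrite /q [in LHS]/poly_p !morE /= !C Y1 Z1 U1 -?expr2.
  exact: psi_identity4.
clearbody q; apply/andP; split; apply/eqP; apply: ext; rewrite tnth_mktuple /=.
- by rewrite p0 Y2.
- rewrite p1 /poly_v; move: poly_p P2 => P P2.
  by rewrite !morE /= P2 C Y2 Z2; apply: psi_identity2.
- rewrite p2 /poly_w; move: poly_p P2 => P P2.
  by rewrite !morE /= P2 !C Y2 Z2 U2 -?expr2; apply: psi_identity3.
- by rewrite q0 Y1.
- rewrite q1 /zi !morE /= Q1 !C Y1 Z1 -?expr2 /poly_v.
  exact: psi_identity5.
- rewrite q2 /ui !morE /= Q1 !C Y1 Z1 U1 -?expr2 /poly_w.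
  exact: psi_identity6.
Qed.

Definition psi : GA 3 L := MkGA psi_subproof.

End Psi.

(* Main.v *)
Require Import Defs.
From HB Require Import structures.
From mathcomp Require Import all_boot all_order all_algebra.
From mathcomp Require Import complex.
From mathcomp Require Import boolp classical_sets reals.
From mathcomp Require Import mpoly ring.

(* Write phi = psi^-1 o theta o psi, theta = (y + x z, G, H), p = y u + z^2.
   Everything is read off at points (x, y, z, u) with values in various rings.

   - At x = 0 the automorphism phi fixes y and maps p to a polynomial in y and p,
     and so does its inverse; hence phi(p) has degree at most 1 in p and
     G(0; y, y T, - y T^2) has degree at most 1 in T.
   - Expanding this along y = t s^4, T = s^-2 gives, for the restriction of G to
     x = 0, G = b(u) z + d(u) y + e(u) z^2 + ... with d + t e(-t) constant.
     At x = y = 0 the polynomial G = z (b + e z + ...) is a component of an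
     automorphism of the plane, so it is gamma z with gamma <> 0 constant.
   - The identity x^2 phi(p) = ((y + x z) H + G^2)(psi), taken along the arc
     x = t s^3 X, y = t s^4, z = 0, u = 1 / (t s^6) modulo X^3, then determines
     the lowest terms in s: G = gamma z + d y - (gamma / 2) x u + ... and
     H = gamma^2 u + .... In weight s^6 X^2 it reads (gamma t / 2)^2 = d, which
     is impossible because d is constant and gamma <> 0. *)

Set Implicit Arguments.
Unset Strict Implicit.
Unset Printing Implicit Defensive.

Import GRing.Theory.
Local Open Scope classical_set_scope.
Local Open Scope ring_scope.

(** * Evaluation of polynomials at points with values in an arbitrary ring *)

Section Points.
Variable F : comNzRingType.
Local Notation PA := {mpoly {poly F}[3]}.
Local Notation px := (('X : {poly F})%:MP_[3]).

(** The coefficient variable x receives a value like y, z, u, so that setting x = 0, passing to a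
    fraction field and moving along an arc are all changes of the point. *)
Definition point_eval (S : comNzRingType) (k : {rmorphism F -> S}) (x y z u : S) :
    PA -> S :=
  mmap (horner_morph (fun a => mulrC x (k a)))
       (tnth [tuple y; z; u]).

Fact point_eval_zmod (S : comNzRingType) k x y z u : zmod_morphism (@point_eval S k x y z u).
Proof. by move=> P Q; rewrite [LHS]rmorphB. Qed.
HB.instance Definition _ (S : comNzRingType) k x y z u :=
  GRing.isZmodMorphism.Build PA S _ (@point_eval_zmod S k x y z u).

Fact point_eval_monoid (S : comNzRingType) k x y z u : monoid_morphism (@point_eval S k x y z u).
Proof. by split=> [|P Q]; rewrite ?[LHS]rmorph1 ?[LHS]rmorphM. Qed.
HB.instance Definition _ (S : comNzRingType) k x y z u :=
  GRing.isMonoidMorphism.Build PA S _ (@point_eval_monoid S k x y z u).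

Section Values.
Variables (S : comNzRingType) (k : {rmorphism F -> S}) (x y z u : S).
Local Notation ev := (point_eval k x y z u).

Lemma point_evalMC p : ev p%:MP = (map_poly k p).[x].
Proof. exact: mmapC. Qed.
Lemma point_evalC a : ev a%:P%:MP = k a.
Proof. by rewrite point_evalMC map_polyC hornerC. Qed.
Lemma point_evalX : ev px = x.
Proof. by rewrite point_evalMC map_polyX hornerX. Qed.
Lemma point_evaly : ev var_y = y.
Proof. by rewrite [LHS]mmapX mmap1U (tnth_nth 0) /= inordK. Qed.
Lemma point_evalz : ev var_z = z.
Proof. by rewrite [LHS]mmapX mmap1U (tnth_nth 0) /= inordK. Qed.
Lemma point_evalu : ev var_u = u.
Proof. by rewrite [LHS]mmapX mmap1U (tnth_nth 0) /= inordK. Qed.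

(** The ring is generated over [F] by x, y, z, u. Naturality in the ring and compatibility with
    substitution both follow from this uniqueness. *)
Lemma rmorph_point_eval (e : {rmorphism PA -> S}) :
    (forall a, e a%:P%:MP = k a) -> e px = x ->
    e var_y = y -> e var_z = z -> e var_u = u -> e =1 ev.
Proof.
move=> ek ex ey ez eu P; rewrite (mpolyE P) !rmorph_sum.
apply: eq_bigr => m _; rewrite -mul_mpolyC !rmorphM mpolyXE_id !rmorph_prod.
congr (_ * _).
  elim/poly_ind: (P@_m) => [|p c IH]; first by rewrite mpolyC0 !rmorph0.
  by rewrite mpolyCD mpolyCM !rmorphD !rmorphM IH ex ek /= point_evalX point_evalC.
apply: eq_bigr => i _; rewrite !rmorphXn /=; congr (_ ^+ _).
rewrite -(inord_val i); case: i => [[|[|[|]]]] //= _.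
- by rewrite [LHS]ey point_evaly.
- by rewrite [LHS]ez point_evalz.
- by rewrite [LHS]eu point_evalu.
Qed.

End Values.

Definition point_evalE :=
  (point_evalC, point_evalX, point_evaly, point_evalz, point_evalu).

Lemma point_eval_morph (S S' : comNzRingType) (k : {rmorphism F -> S})
    (k' : {rmorphism F -> S'}) (g : {rmorphism S -> S'}) x y z u P :
  (forall a, g (k a) = k' a) ->
  g (point_eval k x y z u P) = point_eval k' (g x) (g y) (g z) (g u) P.
Proof.
move=> gk.
apply: (@rmorph_point_eval _ k' _ _ _ _ (g \o point_eval k x y z u)) => [a||||] /=;
  by rewrite ?point_evalE.
Qed.

Lemma point_eval_comp (S : comNzRingType) (k : {rmorphism F -> S}) x y z u P T :
  let ev := point_eval k x y z u in
  ev (P \mPo T) =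
  point_eval k x (ev (tnth T (inord 0))) (ev (tnth T (inord 1)))
             (ev (tnth T (inord 2))) P.
Proof.
apply: (@rmorph_point_eval _ k _ _ _ _ (point_eval k x y z u \o comp_mpoly T))
  => [a||||] /=; rewrite ?[X in point_eval _ _ _ _ _ X = _]comp_mpolyC ?point_evalE //;
  by rewrite /var_y /var_z /var_u comp_mpolyXU -tnth_nth.
Qed.

(** * Expansions with coefficients in F[u] *)

Definition in_u (a : {poly F}) : PA := (map_poly (@mpolyC 3 _ \o polyC) a).[var_u].

Lemma point_eval_in_u (S : comNzRingType) (k : {rmorphism F -> S}) x y z u a :
  point_eval k x y z u (in_u a) = (map_poly k a).[u].
Proof.
rewrite /in_u -horner_map /= point_evalu -map_poly_comp.
by congr (_.[_]); apply: eq_map_poly => b; rewrite [LHS]point_evalC.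
Qed.

(** Polynomials of this form are closed under sum and product and include the constants and x, y, z,
    u. *)
Lemma linear_expansion (P : PA) : exists a P1 P2 P3,
  P = in_u a + var_z * P1 + px * P2 + var_y * P3.
Proof.
pose Q (P : PA) := exists a P1 P2 P3,
  P = in_u a + var_z * P1 + px * P2 + var_y * P3.
have in_uD a b : in_u (a + b) = in_u a + in_u b.
  by rewrite /in_u rmorphD hornerD.
have in_uM a b : in_u (a * b) = in_u a * in_u b.
  by rewrite /in_u rmorphM hornerM.
have in_uC c : in_u c%:P = c%:P%:MP.
  by rewrite /in_u map_polyC hornerC.
have in_uX : in_u 'X = var_u by rewrite /in_u map_polyX hornerX.
have in_u0 : in_u 0 = 0 by rewrite /in_u rmorph0 horner0.
have QD P1 P2 : Q P1 -> Q P2 -> Q (P1 + P2).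
  move=> [a [p [q [r ->]]]] [a' [p' [q' [r' ->]]]].
  exists (a + a'), (p + p'), (q + q'), (r + r').
  by rewrite in_uD; move: (in_u a) (in_u a') => b b'; ring.
have QM P1 P2 : Q P1 -> Q P2 -> Q (P1 * P2).
  move=> [a [p [q [r ->]]]] [a' [p' [q' [r' ->]]]].
  set R := in_u a' + var_z * p' + px * q' + var_y * r'.
  exists (a * a'), (in_u a * p' + p * R), (in_u a * q' + q * R), (in_u a * r' + r * R).
  by rewrite in_uM /R; move: (in_u a) (in_u a') => b b'; ring.
have QC c : Q c%:P%:MP by exists c%:P, 0, 0, 0; rewrite in_uC; ring.
have Qx : Q px by exists 0, 0, 1, 0; rewrite in_u0; ring.
have Qv (i : 'I_3) : Q 'X_i.
  rewrite -(inord_val i); case: i => [[|[|[|]]]] //= _.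
  - by exists 0, 0, 0, 1; rewrite in_u0 -/var_y; ring.
  - by exists 0, 1, 0, 0; rewrite in_u0 -/var_z; ring.
  - by exists 'X, 0, 0, 0; rewrite in_uX -/var_u; ring.
have Q0 : Q 0 by have := QC 0; rewrite polyC0 mpolyC0.
have Q1 : Q 1 by have := QC 1; rewrite polyC1 mpolyC1.
rewrite -/(Q P) (mpolyE P); apply: (big_ind Q) => // m _.
rewrite -mul_mpolyC; apply: (QM).
  elim/poly_ind: (P@_m) => [|p c IH]; first by rewrite mpolyC0.
  by rewrite mpolyCD mpolyCM; apply: (QD) (QC c); apply: QM.
rewrite mpolyXE_id; apply: (big_ind Q) => // i _.
by elim: (m i) => [|j IH]; rewrite ?expr0 // exprS; apply: QM.
Qed.

(* With weights 3, 4, 2, 0 for x, y, z, u the remainder has weight at least 5. *)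
Lemma weighted_expansion (P : PA) : exists a b c d e : {poly F}, exists P1 P2 P3 P4 P5 P6,
  P = in_u a + in_u b * var_z + in_u c * px + in_u d * var_y + in_u e * var_z ^+ 2
      + (var_z ^+ 3 * P1 + var_z * px * P2 + px ^+ 2 * P3 + var_y * var_z * P4
         + px * var_y * P5 + var_y ^+ 2 * P6).
Proof.
have [a [Pz [Px [Py PE]]]] := linear_expansion P.
have [b [Pzz [Pzx [Pzy PzE]]]] := linear_expansion Pz.
have [c [Pxz [Pxx [Pxy PxE]]]] := linear_expansion Px.
have [d [Pyz [Pyx [Pyy PyE]]]] := linear_expansion Py.
have [e [Pzzz [Pzzx [Pzzy PzzE]]]] := linear_expansion Pzz.
exists a, b, c, d, e.
exists Pzzz, (Pzx + Pxz + var_z * Pzzx), Pxx, (Pzy + Pyz + var_z * Pzzy), (Pxy + Pyx), Pyy.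
rewrite PE PzE PxE PyE PzzE.
move: (in_u a) (in_u b) (in_u c) (in_u d) (in_u e) => ? ? ? ? ?.
by ring.
Qed.

(** The coefficients are fixed before the ring and the point, the remainders after them, so one
    expansion serves every specialization. *)
Lemma point_eval_weighted_expansion (P : PA) : exists a b c d e : {poly F},
  forall (S : comNzRingType) (k : {rmorphism F -> S}) x y z u,
  let ev a := (map_poly k a).[u] in
  exists P1 P2 P3 P4 P5 P6,
  point_eval k x y z u P = ev a + ev b * z + ev c * x + ev d * y + ev e * z ^+ 2
      + (z ^+ 3 * P1 + z * x * P2 + x ^+ 2 * P3 + y * z * P4
         + x * y * P5 + y ^+ 2 * P6).
Proof.
have [a [b [c [d [e [P1 [P2 [P3 [P4 [P5 [P6 ->]]]]]]]]]]] := weighted_expansion P.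
exists a, b, c, d, e => S k x y z u ev.
exists (point_eval k x y z u P1), (point_eval k x y z u P2),
  (point_eval k x y z u P3), (point_eval k x y z u P4),
  (point_eval k x y z u P5), (point_eval k x y z u P6).
by rewrite !(rmorphD, rmorphM, rmorphXn) /= !point_eval_in_u !point_evalE.
Qed.

(* The components of [theta^-1 o theta = id] and [theta o theta^-1 = id] at a point,
   for [theta = (y + x z, G, H)] and [theta^-1 = (y - x G', G', H')]. *)
Definition theta_point (G H G' H' : PA) (S : comNzRingType)
    (k : {rmorphism F -> S}) (x y z u : S) :=
  let ev := point_eval k x y z u in
  [/\ point_eval k x (y + x * z) (ev G) (ev H) G' = z,
      point_eval k x (y - x * ev G') (ev G') (ev H') G = z
    & point_eval k x (y - x * ev G') (ev G') (ev H') H = u].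

(* The components of [theta o psi = psi o phi] at a point, for [phi = (y + x v, f, g)];
   [q] is the value of [phi(p)]. *)
Definition phi_point (G H : PA) (S : comNzRingType) (k : {rmorphism F -> S}) (x y z u : S) :=
  let p := y * u + z ^+ 2 in let v := x * z + y * p in
  let w := x ^+ 2 * u - 2 * x * z * p - y * p ^+ 2 in
  exists f g, let q := (y + x * v) * g + f ^+ 2 in
  point_eval k x y v w G = x * f + (y + x * v) * q /\
  point_eval k x y v w H = x ^+ 2 * g - 2 * x * f * q - (y + x * v) * q ^+ 2.

End Points.

(** * Coefficient extraction and elementary identities *)

(** Reads off the lowest order in s of an identity; [P] collects all higher orders. *)
Lemma low_coef (R : comNzRingType) n (c : R) (P : {poly R}) :
  'X^n * (c%:P + 'X * P) = 0 -> c = 0.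
Proof.
move=> /polyP /(_ n); rewrite coefXnM ltnn subnn coefD coefC coefXM addr0.
by rewrite coef0.
Qed.

Lemma coefM012 (R : comNzRingType) (p q : {poly R}) :
  ((p * q)`_0 = p`_0 * q`_0) * ((p * q)`_1 = p`_0 * q`_1 + p`_1 * q`_0) *
  ((p * q)`_2 = p`_0 * q`_2 + p`_1 * q`_1 + p`_2 * q`_0).
Proof. by rewrite !coefM !big_ord_recr !big_ord0 /= !add0r. Qed.

(** Turns a degree bound into an identity between three values. *)
Lemma affine_even_part (K : fieldType) (Q : {poly K}) (c : K) :
  (size Q <= 2)%N -> Q.[c] + Q.[- c] = 2 * Q.[0].
Proof.
move=> szQ; have -> : Q = (Q`_0)%:P + (Q`_1)%:P * 'X.
  apply/polyP => -[|[|i]]; rewrite coefD coefC coefCM coefX /= ?mulr0 ?mulr1 ?addr0 ?add0r //.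
  by rewrite nth_default // (leq_trans szQ).
rewrite !(hornerD, hornerM, hornerC, hornerX); ring.
Qed.

(** For y = t s^4 and T = s^-2 the values y T and y T^2 are again polynomials in s and t. *)
Lemma scale_identities (K : fieldType) (t s : K) : s != 0 ->
  t * s ^+ 4 * s ^- 2 = t * s ^+ 2 /\ t * s ^+ 4 * (s ^- 2) ^+ 2 = t.
Proof. by move=> s0; split; field. Qed.

(** * Descent of a conjugation identity along an injective ring morphism *)

Section Descent.
Variables (n : nat) (A B : comNzRingType) (f : {rmorphism A -> B}).
Hypothesis f_inj : injective f.

Lemma map_mpoly_inj : injective (map_mpoly f : {mpoly A[n]} -> {mpoly B[n]}).
Proof.
move=> P Q /mpolyP PQ; apply/mpolyP => m; apply: f_inj.
by have := PQ m; rewrite !mcoeff_map_mpoly.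
Qed.

Lemma ga_act_map_var (phi : GA n A) i :
  ga_act (ga_map f phi) 'X_i = map_mpoly f (tnth (ga_tuple phi) i).
Proof. by rewrite /ga_act comp_mpolyXU -tnth_nth tnth_mktuple. Qed.

Variables (Psi : n.-tuple {mpoly A[n]}) (psi : GA n B).
Hypothesis psiE : ga_tuple psi = map_tuple_mpoly f Psi.

(** Over [B] the substitution of [Psi] is undone by the inverse of [psi]. *)
Lemma comp_Psi_inj : injective (fun P : {mpoly A[n]} => P \mPo Psi).
Proof.
move=> P Q /= /(congr1 (map_mpoly f)); rewrite !map_mpoly_mPo -psiE => PQ.
apply: map_mpoly_inj; have := congr1 (ga_act (psi^-1)%g) PQ.
by rewrite -!/(ga_act psi _) -!ga_actM mulgV /ga_act !comp_mpoly_id.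
Qed.

(** Multiplying by [psi] on the left removes its inverse; both sides then have coefficients in
    [A]. *)
Lemma conjugate_comptuple (phi theta : GA n A) :
    ga_map f phi = (psi^-1 * ga_map f theta * psi)%g ->
  comptuple Psi (ga_tuple phi) = comptuple (ga_tuple theta) Psi.
Proof.
move=> phiE.
have : (psi * ga_map f phi = ga_map f theta * psi)%g.
  by rewrite phiE !mulgA mulgV mul1g.
move=> /(congr1 (@ga_tuple n B)) /=; rewrite /ga_tuple /= -!/(ga_tuple _) psiE.
rewrite -!map_tuple_comp => e; apply: eq_from_tnth => i; apply: map_mpoly_inj.
by have := congr1 (fun T => tnth T i) e; rewrite /= !tnth_map !tnth_ord_tuple.
Qed.

End Descent.

(** * From the automorphisms to identities at points *)

Section Laurent.
Variable F : fieldType.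
Local Notation px := (('X : {poly F})%:MP_[3]).
Local Notation A := {poly F}.

Lemma poly_laurent_inj : injective (@poly_laurent F).
Proof. by move=> p q [] /eqP; rewrite tofrac_eq => /eqP. Qed.

(** The components of psi lie over F[x]; only its inverse involves x^-1. *)
Definition psi_poly : 3.-tuple {mpoly A[3]} :=
  [tuple var_y; poly_v 'X; poly_w 'X].

Lemma tnth_psi_poly :
  [/\ tnth psi_poly (inord 0) = var_y, tnth psi_poly (inord 1) = poly_v 'X
    & tnth psi_poly (inord 2) = poly_w 'X].
Proof. by split; rewrite (tnth_nth 0) /= inordK. Qed.

Lemma point_eval_psi (S : comNzRingType) (k : {rmorphism F -> S}) (x y z u : S) :
  let ev := point_eval k x y z u in let p := y * u + z ^+ 2 in
  [/\ ev (poly_v 'X) = x * z + y * p,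
      ev (poly_w 'X) = x ^+ 2 * u - 2 * x * z * p - y * p ^+ 2
    & ev (poly_b1 'X) = y + x * (x * z + y * p)].
Proof.
rewrite /poly_v /poly_w /poly_b1 /poly_p.
by split; rewrite !(rmorph_nat, rmorphXn, rmorphB, rmorphD, rmorphM) /= !point_evalE.
Qed.

Lemma map_psi_poly : ga_tuple (psi F) = map_tuple_mpoly (@poly_laurent F) psi_poly.
Proof.
have mapE (C D : comNzRingType) (f : {rmorphism C -> D}) (a : C) :
  [/\ map_mpoly f (poly_v a) = poly_v (f a)
     & map_mpoly f (poly_w a) = poly_w (f a)].
  rewrite /poly_v /poly_w /poly_p /var_y /var_z /var_u.
  by rewrite !(rmorph_nat, rmorphXn, rmorphB, rmorphD, rmorphM) /= !map_mpolyX !map_mpolyC.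
have [ev ew] := mapE _ _ (@poly_laurent F) 'X.
apply: eq_from_tnth => i; rewrite tnth_mktuple -(inord_val i).
case: i => [[|[|[|]]]] //= _; rewrite !(tnth_nth 0) /= inordK //=.
by rewrite map_mpolyX.
Qed.

(** Substituting psi into y + x z gives y + x v = b_1, and this substitution is injective, so the
    first component of theta is forced. *)
Lemma pullback_equations (phi : GA 3 (laurent F)) :
    (GApoly F 3 `&` pullbackGApoly (psi F)) phi ->
    ga_act phi var_y = map_mpoly (@poly_laurent F) (poly_b1 'X) ->
  exists phi0 theta0 : GA 3 A,
    [/\ comptuple psi_poly (ga_tuple phi0) = comptuple (ga_tuple theta0) psi_poly,
        tnth (ga_tuple phi0) (inord 0) = poly_b1 'X
      & tnth (ga_tuple theta0) (inord 0) = var_y + px * var_z].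
Proof.
move=> [[phi0 _ phi0E] [_ [theta0 _ <-] thetaE]] phiy.
exists phi0, theta0.
have comm : comptuple psi_poly (ga_tuple phi0) = comptuple (ga_tuple theta0) psi_poly.
  apply: (conjugate_comptuple poly_laurent_inj map_psi_poly).
  by rewrite phi0E -thetaE.
have y1 : tnth (ga_tuple phi0) (inord 0) = poly_b1 'X.
  apply: (map_mpoly_inj poly_laurent_inj); rewrite -phiy -phi0E.
  exact/esym/ga_act_map_var.
split; [exact: comm | exact: y1 |].
apply: (comp_Psi_inj poly_laurent_inj map_psi_poly).
have := congr1 (fun T => tnth T (inord 0)) comm.
rewrite [in X in X -> _]tnth_mktuple.
rewrite [in X in X -> _]tnth_mktuple.
move=> <-.
have [psi0 psi1 _] := tnth_psi_poly.
rewrite psi0 comp_mpolyXU -tnth_nth y1.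
rewrite rmorphD rmorphM /= comp_mpolyC.
rewrite !comp_mpolyXU -!tnth_nth psi0 psi1.
by [].
Qed.

Lemma point_equations (phi : GA 3 (laurent F)) :
    (GApoly F 3 `&` pullbackGApoly (psi F)) phi ->
    ga_act phi var_y = map_mpoly (@poly_laurent F) (poly_b1 'X) ->
  exists G H G' H' : {mpoly A[3]},
  forall (S : comNzRingType) (k : {rmorphism F -> S}) (x y z u : S),
  theta_point G H G' H' k x y z u /\ phi_point G H k x y z u.
Proof.
move=> phiI phiy; have [phi0 [theta0 [comm y1 y2]]] := pullback_equations phiI phiy.
have [TT' T'T] := ga_pairP theta0.
set T := ga_tuple theta0 in comm y2; rewrite -/(ga_tuple theta0) -/T in TT' T'T.
set T' := (ga_pair theta0).2 in TT' T'T.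
set V := ga_tuple phi0 in comm y1.
exists (tnth T (inord 1)), (tnth T (inord 2)), (tnth T' (inord 1)), (tnth T' (inord 2)).
move=> S k x y z u; pose ev := point_eval k x y z u.
have evT : ev (tnth T (inord 0)) = y + x * z.
  by rewrite y2 /ev rmorphD rmorphM /= !point_evalE.
have evc U W i : ev (tnth (comptuple U W) i) =
  point_eval k x (ev (tnth W (inord 0))) (ev (tnth W (inord 1))) (ev (tnth W (inord 2)))
    (tnth U i) by rewrite /ev tnth_mktuple point_eval_comp.
have ev_id : [/\ ev (tnth idtuple (inord 0)) = y, ev (tnth idtuple (inord 1)) = z
   & ev (tnth idtuple (inord 2)) = u].
  by rewrite !tnth_mktuple; split; rewrite -/var_y -/var_z -/var_u /ev ?point_evalE.
have [id0 id1 id2] := ev_id.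
(* The first component of theta o theta^-1 = id determines that of theta^-1. *)
have evT' : ev (tnth T' (inord 0)) = y - x * ev (tnth T' (inord 1)).
  have := evc T T' (inord 0); rewrite TT' id0 y2 rmorphD rmorphM /= !point_evalE.
  by move=> ->; rewrite addrK.
split; first (split; rewrite -/ev).
- by rewrite -evT -evc T'T id1.
- by rewrite -evT' -evc TT' id1.
- by rewrite -evT' -evc TT' id2.
pose p := y * u + z ^+ 2; pose v := x * z + y * p.
pose w := x ^+ 2 * u - 2 * x * z * p - y * p ^+ 2.
have [psi0 psi1 psi2] := tnth_psi_poly.
have [evv evw evb] := point_eval_psi k x y z u.
have evP (i : 'I_3) : ev (tnth (comptuple psi_poly V) i) = point_eval k x y v w (tnth T i).
  by rewrite comm evc psi0 psi1 psi2 /ev evv evw point_evaly.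
exists (ev (tnth V (inord 1))), (ev (tnth V (inord 2))).
rewrite -/p -/v -/w.
rewrite -!evP !evc psi1 psi2 y1 /ev evb.
have [ev' ew' _] := point_eval_psi k x (y + x * v) (ev (tnth V (inord 1)))
  (ev (tnth V (inord 2))).
split; [exact: ev' | exact: ew'].
Qed.

End Laurent.

(** * The restriction to x = 0 *)

Section Core.
Variables (F : fieldType) (G H G' H' : {mpoly {poly F}[3]}).

Hypothesis theta_pts : forall (S : comNzRingType) (k : {rmorphism F -> S}) x y z u,
  theta_point G H G' H' k x y z u.
Hypothesis phi_pts : forall (S : comNzRingType) (k : {rmorphism F -> S}) x y z u,
  phi_point G H k x y z u.
Hypothesis two_neq0 : 2 != 0 :> F.

(** At z = 0, u = T / y one has p = T, and theta maps (y, y T, - y T^2) to (y, y q, - y q^2) with q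
    the value of phi(p). Applying [G'] gives P(q(T)) = y T for P(T) = G'(0; y, y T, - y T^2).
    Degrees multiply under composition, so q has degree 1. *)
Lemma special_fiber_affine (K : fieldType) (k : {rmorphism F -> K}) (y : K) :
  y != 0 ->
  (size (point_eval (polyC \o k) 0 y%:P (y%:P * 'X) (- (y%:P * 'X^2)) G) <= 2)%N.
Proof.
move=> y0; pose kk : {rmorphism F -> {poly K}} := polyC \o k.
have [f [g]] := phi_pts kk 0 y%:P 0 (y^-1%:P * 'X).
set q := _ * g + _ => /=.
have -> : y%:P * (y^-1%:P * 'X) + 0 ^+ 2 = 'X :> {poly K}.
  by rewrite mulrA -polyCM mulfV // mul1r expr0n addr0.
rewrite expr0n /= !(mul0r, mulr0, oppr0, add0r, addr0) => -[GE HE].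
have [thE _ _] := theta_pts kk 0 y%:P (y%:P * 'X) (- (y%:P * 'X^2)).
move: thE; rewrite /= mul0r addr0 GE HE => thE.
pose P := point_eval kk 0 y%:P (y%:P * 'X) (- (y%:P * 'X^2)) G'.
have PE : P \Po q = y%:P * 'X.
  rewrite -[RHS]thE /P.
  rewrite (point_eval_morph (k' := kk) (g := comp_poly q)); last first.
    by move=> a; rewrite /= comp_polyC.
  by rewrite rmorph0 rmorphN !(rmorphXn, rmorphM) /= comp_polyC comp_polyX.
have : ((size P).-1 * (size q).-1)%N = 1%N.
  by rewrite -size_comp_poly PE mul_polyC size_scale // size_polyX.
move=> /eqP; rewrite muln_eq1 => /andP[_ /eqP sq].
have : (size (y%:P * q)%R <= 2)%N.
  by rewrite mul_polyC size_scale //; case: (size q) sq => [|[|[]]].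
by rewrite -GE.
Qed.

Local Notation D := {poly F}.
Local Notation DD := {poly D}.
Local Notation kDD := (polyC \o polyC : {rmorphism F -> DD}).
Local Notation t := ('X%:P : DD).
Local Notation s := ('X : DD).

(** For y = t s^4 the affine polynomial in T is taken at s^-2, - s^-2 and 0. Only T needs the
    fraction field; the resulting points, and hence the identity, lie in F[t][s]. *)
Lemma fiber_even_part :
  let ev := point_eval kDD 0 in
  ev (t * s ^+ 4) (t * s ^+ 2) (- t) G + ev (t * s ^+ 4) (- (t * s ^+ 2)) (- t) G
  = 2 * ev (t * s ^+ 4) 0 0 G.
Proof.
move=> ev; pose kK : {rmorphism F -> {fraction DD}} := @tofrac DD \o kDD.
have ts0 : t * s ^+ 4 != 0 :> DD by rewrite mulf_neq0 ?polyC_eq0 ?expf_neq0 ?polyX_eq0.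
pose y := tofrac (t * s ^+ 4); have y0 : y != 0 by rewrite tofrac_eq0.
pose Q := point_eval (polyC \o kK) 0 y%:P (y%:P * 'X) (- (y%:P * 'X^2)) G.
have szQ : (size Q <= 2)%N by apply: special_fiber_affine.
have Qev c u v : y * c = tofrac u -> - (y * c ^+ 2) = tofrac v ->
    Q.[c] = tofrac (ev (t * s ^+ 4) u v G).
  move=> uE vE; rewrite -[LHS]/(horner_eval c Q) /Q.
  rewrite (point_eval_morph (k' := kK) (g := horner_eval c)); last first.
    by move=> a; rewrite /= /horner_eval hornerC.
  rewrite (point_eval_morph (k' := kK) (g := @tofrac DD)) //.
  have hu : (y%:P * 'X).[c] = tofrac u by rewrite hornerM hornerC hornerX uE.
  have hv : (- (y%:P * 'X^2)).[c] = tofrac v.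
    by rewrite hornerN hornerM hornerC hornerXn vE.
  rewrite /horner_eval; congr (point_eval kK _ _ _ _ G).
  - exact: etrans (horner0 _) (esym (tofrac0 _)).
  - exact: hornerC.
  - exact: hu.
  - exact: hv.
have [c [y2 y1]] : exists c, y * c = tofrac (t * s ^+ 2) /\ y * c ^+ 2 = tofrac t.
  exists (tofrac s ^- 2); rewrite /y !(tofracXn, tofracM).
  have : tofrac s != 0 by rewrite tofrac_eq0 polyX_eq0.
  exact: scale_identities.
have e1 := Qev c (t * s ^+ 2) (- t); have e2 := Qev (- c) (- (t * s ^+ 2)) (- t).
have e3 : Q.[0] = _ := Qev 0 0 0 _ _.
apply/eqP; rewrite -tofrac_eq tofracD tofracM; apply/eqP.
rewrite -e1 ?y1 ?tofracN // -e2 ?mulrN ?sqrrN ?y1 ?y2 ?tofracN // -e3.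
- by rewrite rmorph_nat affine_even_part.
- by rewrite mulr0 tofrac0.
- by rewrite expr0n mulr0 oppr0 tofrac0.
Qed.

(** * Lowest coefficients of G on x = 0 *)

Variables (a b c d e : {poly F}).
Hypothesis G_expansion :
  forall (S : comNzRingType) (k : {rmorphism F -> S}) x y z u,
  let ev a := (map_poly k a).[u] in
  exists P1 P2 P3 P4 P5 P6,
  point_eval k x y z u G = ev a + ev b * z + ev c * x + ev d * y + ev e * z ^+ 2
      + (z ^+ 3 * P1 + z * x * P2 + x ^+ 2 * P3 + y * z * P4
         + x * y * P5 + y ^+ 2 * P6).

Lemma horner_map_polyC (p q : {poly F}) : (map_poly kDD p).[q%:P] = (p \Po q)%:P.
Proof. by rewrite map_poly_comp horner_map /=. Qed.

Lemma comp_polyNX (p q : {poly F}) : p \Po (- 'X) = q -> p = q \Po (- 'X).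
Proof. by move=> <-; rewrite -comp_polyA rmorphN /= comp_polyX opprK comp_polyXr. Qed.

(** These are the orders s^0 and s^4 of [fiber_even_part]; the contribution of [b] is odd in z and
    cancels. *)
Lemma special_fiber_coefs : a = 0 /\ d \Po (- 'X) + 'X * (e \Po (- 'X)) = (d`_0)%:P.
Proof.
(* At x = y = 0 the equation for [G] has right-hand side 0. *)
have a0 : a`_0 = 0.
  have [f [g]] := phi_pts idfun 0 0 0 0; rewrite /=.
  rewrite !(expr0n, mul0r, mulr0, oppr0, add0r, addr0) /= => -[G0 _].
  have [P1 [P2 [P3 [P4 [P5 [P6]]]]]] := G_expansion idfun 0 0 0 0.
  rewrite G0 /= !(expr0n, mul0r, mulr0, oppr0, add0r, addr0) /= map_poly_id // => E.
  by rewrite -horner_coef0 -E.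
have := fiber_even_part => /=.
have [P1 [P2 [P3 [P4 [P5 [P6 ->]]]]]] := G_expansion kDD 0 (t * s ^+ 4) (t * s ^+ 2) (- t).
have [Q1 [Q2 [Q3 [Q4 [Q5 [Q6 ->]]]]]] := G_expansion kDD 0 (t * s ^+ 4) (- (t * s ^+ 2)) (- t).
have [R1 [R2 [R3 [R4 [R5 [R6 ->]]]]]] := G_expansion kDD 0 (t * s ^+ 4) 0 0.
rewrite -[- t]polyCN !horner_map_polyC !comp_poly0r a0.
set a' := a \Po _; set b' := b \Po _; set c' := c \Po _.
set d' := d \Po _; set e' := e \Po _; set d0 := d`_0.
move=> /eqP; rewrite -subr_eq0 => /eqP E.
have two : (2 : D) != 0 by rewrite -polyC_natr polyC_eq0.
have twoC : (2 : DD) = (2 : D)%:P by rewrite polyC_natr.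
(* The remainders of the three expansions, combined and divided by s^5. *)
pose R := t ^+ 3 * s * (P1 - Q1) + t ^+ 2 * s * (P4 - Q4)
  + t ^+ 2 * s ^+ 3 * (P6 + Q6 - 2 * R6).
have a'0 : a' = 0.
  have /eqP : 2 * a' = 0.
    apply: (@low_coef D 0 _ (s ^+ 3 * (2 * t * (d'%:P + t * e'%:P - d0%:P%:P) + s * R))).
    by rewrite -[RHS]E /R polyCM -twoC polyC0; ring.
  by rewrite mulf_eq0 (negPf two) => /eqP.
split; first by rewrite (comp_polyNX a'0) comp_polyC.
have /eqP : 2 * 'X * (d' + 'X * e' - d0%:P) = 0.
  apply: (@low_coef D 4 _ R).
  rewrite -[RHS]E /R a'0 !(polyCM, polyCD, polyCN, polyC1, polyC0); ring.
by rewrite !mulf_eq0 (negPf two) polyX_eq0 subr_eq0 => /eqP.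
Qed.

(** * The automorphism of the plane x = y = 0 *)

Variables (A B : {poly F}).
Hypothesis H_expansion :
  forall (S : comNzRingType) (k : {rmorphism F -> S}) x y z u,
  let ev a := (map_poly k a).[u] in
  exists P1 P2 P3,
  point_eval k x y z u H = ev A + ev B * z + (x * P1 + y * P2 + z ^+ 2 * P3).

(** By [theta_point] at x = y = 0, [G'] takes every value there, in particular 0 and 1. *)
Lemma plane_inverse_nonconstant (g : F) :
  point_eval kDD 0 0 'X t G' <> g%:P%:P.
Proof.
move=> gE; have pt z : exists y u, point_eval idfun 0 0 y u G' = z.
  have [] := theta_pts idfun 0 0 z 0; rewrite mul0r addr0 => + _ _.
  by set y := point_eval _ _ _ _ _ G; set u := point_eval _ _ _ _ _ H; exists y, u.
have val z u : point_eval idfun 0 0 z u G' = g.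
  have /(congr1 (fun q : DD => q.[z%:P].[u])) := gE; rewrite !hornerC => <-.
  pose ev : {rmorphism DD -> F} := horner_eval u \o horner_eval z%:P.
  rewrite -[RHS]/(ev _) (point_eval_morph (k' := idfun) (g := ev)); last first.
    by move=> a'; rewrite /= /horner_eval !hornerC.
  by rewrite /= /horner_eval !horner0 hornerX !hornerC hornerX.
have [y [u]] := pt 0; rewrite val => g0.
have [y' [u']] := pt 1; rewrite val g0 => /eqP.
by rewrite eq_sym oner_eq0.
Qed.

(** Substituting theta^-1 into G = z (b + e z + z^2 P1) factors s in F[t][s]. The factor [g'] is not
    constant, so [k'] is. At s = 0, where [g'] vanishes, this gives [b], and after a division by
    [g'] it gives [e]. *)
Lemma plane_component : a = 0 -> exists2 g : F, g != 0 & b = g%:P /\ e = 0.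
Proof.
move=> a0; have [_] := theta_pts kDD 0 0 'X t; rewrite !(mul0r, subr0).
set g' := point_eval _ _ _ _ _ G'; set h' := point_eval _ _ _ _ _ H' => gE hE.
have [P1 [P2 [P3 [P4 [P5 [P6]]]]]] := G_expansion kDD 0 0 g' h'.
rewrite gE a0 rmorph0 /= horner0 !(mul0r, mulr0, expr0n, add0r, addr0) /=.
set eb := (map_poly _ b).[_]; set ee := (map_poly _ e).[_] => Gz.
have [Q1 [Q2 [Q3]]] := H_expansion kDD 0 0 g' h'.
rewrite hE !(mul0r, add0r); set eA := _.[_] => Hu.
pose k' := eb + ee * g' + g' ^+ 2 * P1.
have gk : g' * k' = 'X by rewrite Gz /k'; ring.
have [g0 k0] : g' != 0 /\ k' != 0.
  by apply/andP; rewrite -negb_or -mulf_eq0 gk polyX_eq0.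
have sgk : (size g' + size k')%N = 3.
  have := size_mul g0 k0; rewrite gk size_polyX => /(congr1 S).
  by rewrite prednK // addn_gt0 lt0n size_poly_eq0 g0.
(* A factor free of s is a unit of F[t]: its product with the coefficient of s in the other factor
   is 1. *)
have coef1 (q r : DD) : (size q <= 1)%N -> q * r = 'X -> exists2 f : F, f != 0 & q = f%:P%:P.
  move=> /size1_polyC -> E; have /(congr1 (fun p : DD => p`_1)) := E.
  rewrite coefCM coefX /= => E1.
  have : q`_0 \is a GRing.unit by apply/unitrPr; exists r`_1.
  rewrite poly_unitE => /andP[/eqP s1 u1]; exists (q`_0)`_0.
    by rewrite unitfE in u1.
  by congr (_%:P); apply: size1_polyC; rewrite s1.
have : (size g' <= 1)%N || (size k' <= 1)%N.
  apply: contraT; rewrite negb_or -!ltnNge => /andP[sg sk].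
  by have := leq_add sg sk; rewrite sgk.
case/orP => [sg|sk].
  by have [f _ /plane_inverse_nonconstant] := coef1 _ _ sg gk.
have [f f0 kE] := coef1 k' g' sk (etrans (mulrC _ _) gk).
pose h0 := h'.[0].
have ev0 p : ((map_poly kDD p).[h']).[0] = p \Po h0.
  rewrite -[LHS]/(horner_eval 0 _) -horner_map -map_poly_comp /comp_poly.
  by congr (_.[_]); apply: eq_map_poly => x; rewrite /= /horner_eval hornerC.
have g'0 : g'.[0] = 0.
  have /(congr1 (fun p : DD => p.[0])) := gk; rewrite hornerM kE hornerC hornerX.
  by move=> /eqP; rewrite mulf_eq0 polyC_eq0 (negPf f0) orbF => /eqP.
(* At s = 0 the identity for [H] becomes A(h0) = t, so h0 has degree 1 and substituting it is
   injective. *)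
have sh0 : (1 < size h0)%N.
  have /(congr1 (fun p : DD => p.[0])) := Hu.
  rewrite !(hornerD, hornerM, hornerXn) g'0 hornerC ev0 !(mul0r, mulr0, addr0) => AE.
  have : ((size A).-1 * (size h0).-1)%N = 1%N by rewrite -size_comp_poly -AE size_polyX.
  by move=> /eqP; rewrite muln_eq1 => /andP[_]; case: (size h0) => [|[]].
have comp0 p : p \Po h0 = 0 -> p = 0.
  by move=> /eqP; rewrite comp_poly_eq0 // => /eqP.
have bE : b = f%:P.
  apply/eqP; rewrite -subr_eq0; apply/eqP/comp0.
  rewrite rmorphB /= comp_polyC -ev0 -/eb.
  have /(congr1 (fun p : DD => p.[0])) := kE.
  by rewrite /k' !(hornerD, hornerM) g'0 hornerC !(mul0r, mulr0, addr0) => ->; rewrite subrr.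
exists f => //; split=> //; apply: comp0; rewrite -ev0 -/ee.
have : g' * (ee + g' * P1) = 0.
  move: kE; rewrite /k' /eb bE map_polyC hornerC => /eqP.
  by rewrite -subr_eq0 => /eqP <- /=; ring.
move=> /eqP; rewrite mulf_eq0 (negPf g0) => /eqP /(congr1 (fun p : DD => p.[0])).
by rewrite hornerD hornerM g'0 mul0r addr0 horner0.
Qed.


(** * The arc x = t s^3 X, y = t s^4, z = 0, u = 1 / (t s^6) *)

(** In order: y u = p = s^-2, y p = v, the coefficient of X^2 in x^2 u, and y p^2; the last two give
    w = t (X^2 - 1). *)
Lemma arc_identities (K : fieldType) (T S : K) : T != 0 -> S != 0 ->
  [/\ T * S ^+ 4 * (T * S ^+ 6)^-1 = S ^- 2, T * S ^+ 4 * S ^- 2 = T * S ^+ 2,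
      (T * S ^+ 3) ^+ 2 * (T * S ^+ 6)^-1 = T
    & T * S ^+ 4 * (S ^- 2) ^+ 2 = T].
Proof. by move=> T0 S0; split; field; rewrite ?T0 ?S0. Qed.

(** After [tau], [E] is x^2 q with q the value of phi(p), and X divides x. As G = x f + (y + x v) q,
    the constant term of [g] is t s^4 q_0, which eliminates q_0 from E_2 = (t s^3)^2 q_0. The field
    [K] is needed only for the inverses in u and p. *)
Lemma arc_relation (R : comNzRingType) (K : fieldType) (k : {rmorphism F -> R})
    (tau : {rmorphism R -> K}) (t s : R) :
  injective tau -> t != 0 -> s != 0 ->
  let x := (t * s ^+ 3)%:P * 'X in let y := (t * s ^+ 4)%:P in
  let v := (t * s ^+ 2)%:P in let w := t%:P * ('X^2 - 1) in
  let g := point_eval (polyC \o k) x y v w G in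
  let E := (y + x * v) * point_eval (polyC \o k) x y v w H + g ^+ 2 in
  [/\ E`_0 = 0, E`_1 = 0 & E`_2 = t * s ^+ 2 * g`_0].
Proof.
move=> tau_inj t0 s0 x y v w g E.
pose M : {rmorphism {poly R} -> {poly K}} := map_poly tau.
pose kP : {rmorphism F -> {poly K}} := polyC \o (tau \o k).
pose T := tau t; pose S := tau s.
have tau_neq0 r : r != 0 -> tau r != 0 by rewrite -(inj_eq tau_inj) rmorph0.
have [I1 I2 I3 I4] := arc_identities (tau_neq0 _ t0) (tau_neq0 _ s0).
rewrite -/T -/S in I1 I2 I3 I4.
have tsE n : tau (t * s ^+ n) = T * S ^+ n by rewrite rmorphM rmorphXn.
have Mx : M x = (T * S ^+ 3)%:P * 'X by rewrite /M /= rmorphM /= map_polyC map_polyX /= tsE.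
have My : M y = (T * S ^+ 4)%:P by rewrite /M /= map_polyC /= tsE.
have Mv : M v = (T * S ^+ 2)%:P by rewrite /M /= map_polyC /= tsE.
have Mw : M w = T%:P * ('X^2 - 1).
  by rewrite /M /= rmorphM rmorphB rmorph1 /= map_polyC map_polyXn.
have Mev P : M (point_eval (polyC \o k) x y v w P) =
    point_eval kP (M x) (M y) (M v) (M w) P.
  by apply: point_eval_morph => r; rewrite /M /= map_polyC.
have := phi_pts kP (M x) (M y) 0 (T * S ^+ 6)^-1%:P.
rewrite /phi_point.
have pE : M y * (T * S ^+ 6)^-1%:P + 0 ^+ 2 = (S ^- 2)%:P.
  by rewrite My -polyCM I1 expr0n addr0.
have vE : M x * 0 + M y * (S ^- 2)%:P = M v.
  by rewrite mulr0 add0r My Mv -polyCM I2.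
have wE : M x ^+ 2 * (T * S ^+ 6)^-1%:P - 2 * M x * 0 * (S ^- 2)%:P
    - M y * (S ^- 2)%:P ^+ 2 = M w.
  rewrite mulr0 mul0r subr0 Mx My Mw exprMn mulrAC -!polyC_exp -!polyCM I3 I4.
  by rewrite mulrBr mulr1.
rewrite /= pE vE wE -!Mev => -[f [f' /=]].
set q := _ * f' + _; rewrite -/g => -[gE hE].
have ME : M E = M x ^+ 2 * q.
  transitivity ((M y + M x * M v) * M (point_eval (polyC \o k) x y v w H) + M g ^+ 2).
    by rewrite -rmorphM -rmorphD -rmorphM -rmorphXn -rmorphD.
  by rewrite [M g]gE [M (point_eval _ _ _ _ _ H)]hE /q; ring.
have ME_coef i : tau E`_i = ((T * S ^+ 3) ^+ 2) * ('X^2 * q)`_i.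
  by rewrite -[LHS]coef_map -[map_poly _ _]/(M E) ME Mx exprMn -polyC_exp -mulrA coefCM.
have g0 : tau g`_0 = T * S ^+ 4 * q`_0.
  rewrite -[LHS]coef_map [map_poly _ g]gE Mx My Mv.
  by rewrite coefD !coef0M coefD !coef0M !coefC coefX /= !(mulr0, mul0r) addr0 add0r.
split; apply: tau_inj.
- by rewrite ME_coef coefXnM mulr0 rmorph0.
- by rewrite ME_coef coefXnM mulr0 rmorph0.
- rewrite ME_coef coefXnM /= rmorphM tsE g0.
  by ring.
Qed.

(** The coefficients of 1, X, X^2 in [arc_relation]. Since x, y, v have orders 3, 4, 2 in s, the
    remainder of G is divisible by s^5 and that of H by s^3. *)
Lemma arc_equations (R : comNzRingType) (K : fieldType) (k : {rmorphism F -> R})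
    (tau : {rmorphism R -> K}) (t s : R) (b0 d0 : F) :
  a = 0 -> b = b0%:P -> d = d0%:P -> e = 0 ->
  injective tau -> t != 0 -> s != 0 ->
  let ev p := (map_poly (polyC \o k) p).[t%:P * ('X^2 - 1)] in
  exists g0 g1 g2 h0 h1 h2 : R,
  let g_0 := k b0 * t * s ^+ 2 + k d0 * t * s ^+ 4 + s ^+ 5 * g0 in
  let g_1 := t * s ^+ 3 * (ev c)`_0 + s ^+ 5 * g1 in
  let g_2 := t * s ^+ 3 * (ev c)`_1 + s ^+ 5 * g2 in
  let h_0 := (ev A)`_0 + t * s ^+ 2 * (ev B)`_0 + s ^+ 3 * h0 in
  let h_1 := (ev A)`_1 + t * s ^+ 2 * (ev B)`_1 + s ^+ 3 * h1 in
  let h_2 := (ev A)`_2 + t * s ^+ 2 * (ev B)`_2 + s ^+ 3 * h2 in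
  [/\ t * s ^+ 4 * h_0 + g_0 ^+ 2 = 0,
      t * s ^+ 4 * h_1 + t ^+ 2 * s ^+ 5 * h_0 + 2 * g_0 * g_1 = 0
    & t * s ^+ 4 * h_2 + t ^+ 2 * s ^+ 5 * h_1 + 2 * g_0 * g_2 + g_1 ^+ 2
      = t * s ^+ 2 * g_0].
Proof.
move=> a0 bE dE e0 tau_inj t0 s0 ev.
have [] := arc_relation k tau_inj t0 s0.
set x := _ * 'X; set y := (t * s ^+ 4)%:P; set v := (t * s ^+ 2)%:P.
rewrite /=; set w := t%:P * _; set g := point_eval _ _ _ _ _ G.
set h := point_eval _ _ _ _ _ H.
have [P1 [P2 [P3 [P4 [P5 [P6]]]]]] := G_expansion (polyC \o k) x y v w.
have [Q1 [Q2 [Q3]]] := H_expansion (polyC \o k) x y v w.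
rewrite -/g -/h /= -!/(ev _) => hE gE.
have evC r : ev r%:P = (k r)%:P by rewrite /ev map_polyC hornerC.
rewrite a0 bE dE e0 !evC !rmorph0 in gE.
(* The remainders of [G] and [H] divided by s^5 and s^3. *)
pose Rg := (t ^+ 3 * s)%:P * P1 + (t ^+ 2)%:P * 'X * P2 + (t ^+ 2 * s)%:P * 'X^2 * P3
  + (t ^+ 2 * s)%:P * P4 + (t ^+ 2 * s ^+ 2)%:P * 'X * P5 + (t ^+ 2 * s ^+ 3)%:P * P6.
pose Rh := t%:P * 'X * Q1 + (t * s)%:P * Q2 + (t ^+ 2 * s)%:P * Q3.
have {gE}gE : g = (k b0 * t * s ^+ 2 + k d0 * t * s ^+ 4)%:P
    + (t * s ^+ 3)%:P * ('X * ev c) + (s ^+ 5)%:P * Rg.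
  by rewrite gE /x /y /v /Rg !(polyC_exp, polyCM, polyCD); ring.
have {hE}hE : h = ev A + (t * s ^+ 2)%:P * ev B + (s ^+ 3)%:P * Rh.
  by rewrite hE /x /y /v /Rh !(polyC_exp, polyCM, polyCD); ring.
have yv : y + x * v = (t * s ^+ 4)%:P + (t ^+ 2 * s ^+ 5)%:P * 'X.
  by rewrite /x /y /v !(polyC_exp, polyCM, polyCD); ring.
clearbody Rg Rh.
have g_0 : g`_0 = k b0 * t * s ^+ 2 + k d0 * t * s ^+ 4 + s ^+ 5 * Rg`_0.
  by rewrite gE !coefD !coefCM coefC coefXM /= mulr0 addr0.
have g_1 : g`_1 = t * s ^+ 3 * (ev c)`_0 + s ^+ 5 * Rg`_1.
  by rewrite gE !coefD !coefCM coefC coefXM /= add0r.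
have g_2 : g`_2 = t * s ^+ 3 * (ev c)`_1 + s ^+ 5 * Rg`_2.
  by rewrite gE !coefD !coefCM coefC coefXM /= add0r.
have h_ i : h`_i = (ev A)`_i + t * s ^+ 2 * (ev B)`_i + s ^+ 3 * Rh`_i.
  by rewrite hE !coefD !coefCM.
have yv_ : ((y + x * v)`_0 = t * s ^+ 4) * ((y + x * v)`_1 = t ^+ 2 * s ^+ 5)
    * ((y + x * v)`_2 = 0).
  by rewrite yv !coefD !coefCM !coefC !coefX /= !(mulr0, mulr1, addr0, add0r).
rewrite !coefD expr2 !coefM012 !yv_ !h_ => E0 E1 E2.
exists Rg`_0, Rg`_1, Rg`_2, Rh`_0, Rh`_1, Rh`_2.
rewrite -!h_ -g_0 -g_1 -g_2 in E0 E1 E2 *.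
split; [by rewrite -[RHS]E0 | by rewrite -[RHS]E1; ring | by rewrite -E2; ring].
Qed.

(** At X = 0 the value of w is - t. *)
Lemma arc_value0 (p : {poly F}) :
  ((map_poly (polyC \o kDD) p).[t%:P * ('X^2 - 1)])`_0 = (p \Po (- 'X))%:P.
Proof.
rewrite -horner_coef0 -[LHS]/(horner_eval 0 _).
rewrite -horner_map -map_poly_comp -horner_map_polyC polyCN.
have -> : map_poly (horner_eval 0 \o (polyC \o kDD)) p = map_poly kDD p.
  by apply: eq_map_poly => r; rewrite /= /horner_eval hornerC.
congr (_.[_]); rewrite [LHS]/(horner_eval 0 _) /horner_eval.
by rewrite hornerM hornerC hornerD hornerN hornerXn hornerC expr0n sub0r mulrN mulr1.
Qed.

Lemma arc_value_linear (r : F) (p := r%:P * 'X) :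
  let ev := (map_poly (polyC \o kDD) p).[t%:P * ('X^2 - 1)] in
  ev`_1 = 0 /\ ev`_2 = r%:P%:P * t.
Proof.
rewrite /= rmorphM /= map_polyC map_polyX hornerM hornerC hornerX.
rewrite !coefCM !coefB !coefXn !coef1 /= !subr0 mulr0 mulr1.
by rewrite mulr0.
Qed.

(** * Comparison of lowest terms in s, and the contradiction *)

Lemma point_equations_absurd : False.
Proof.
have [a0 de] := special_fiber_coefs.
have [gamma gamma0 [bE e0]] := plane_component a0.
set dl := d`_0 in de.
(* With e = 0 the relation between [d] and [e] says that d(- t) is constant. *)
have dE : d = dl%:P.
  by move: de; rewrite e0 comp_polyC mulr0 addr0 => /comp_polyNX; rewrite comp_polyC.
have tofrac_inj : injective (@tofrac DD) by move=> p q /eqP; rewrite tofrac_eq => /eqP.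
have X0 : 'X != 0 :> D by rewrite polyX_eq0.
have t0 : t != 0 by rewrite polyC_eq0.
have s0 : s != 0 by rewrite polyX_eq0.
have := arc_equations kDD a0 bE dE e0 tofrac_inj t0 s0.
set ev := fun p => _.[_]; rewrite -/ev.
have ev0 p : (ev p)`_0 = (p \Po (- 'X))%:P := arc_value0 p.
have evl r : (ev (r%:P * 'X))`_1 = 0 /\ (ev (r%:P * 'X))`_2 = r%:P%:P * t.
  exact: arc_value_linear.
have evc r : (ev r%:P)`_1 = 0 /\ (ev r%:P)`_2 = 0.
  by rewrite /ev map_polyC hornerC !coefC.
clearbody ev => /= -[g0 [g1 [g2 [h0 [h1 [h2 []]]]]]]; rewrite !ev0.
set A' := A \Po (- 'X); set B' := B \Po (- 'X); set C' := c \Po (- 'X).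
set ga : DD := gamma%:P%:P; set de' : DD := dl%:P%:P => E0 E1 E2.
(* Order s^4 of the X^0 equation; the last argument of [low_coef] is everything beyond it, divided
   by s^5. *)
have A'E : A' = - (gamma ^+ 2)%:P * 'X.
  have /eqP : 'X * (A' + (gamma ^+ 2)%:P * 'X) = 0.
    apply: (@low_coef D 4 _ (s * (t ^+ 2 * B'%:P + 2 * ga * de' * t ^+ 2)
      + s ^+ 2 * (t * h0 + 2 * ga * t * g0) + s ^+ 3 * (de' ^+ 2 * t ^+ 2)
      + s ^+ 4 * (2 * de' * t * g0) + s ^+ 5 * g0 ^+ 2)).
    by rewrite -[RHS]E0 !(polyC_exp, polyCM, polyCD) -/ga -/de'; ring.
  by rewrite mulf_eq0 (negPf X0) addr_eq0 -mulNr => /eqP.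
have AE : A = (gamma ^+ 2)%:P * 'X.
  by rewrite (comp_polyNX A'E) rmorphM rmorphN /= comp_polyC comp_polyX mulrNN.
(* Order s^6 of the same equation, whose s^4 term is now gone. *)
have B'E : B' = (- (2 * gamma * dl))%:P.
  have /eqP : 'X ^+ 2 * (B' + (2 * gamma * dl)%:P) = 0.
    apply: (@low_coef D 6 _ (t * h0 + 2 * ga * t * g0 + s * (de' ^+ 2 * t ^+ 2)
      + s ^+ 2 * (2 * de' * t * g0) + s ^+ 3 * g0 ^+ 2)).
    by rewrite -[RHS]E0 A'E !(polyCN, polyC_exp, polyCM, polyCD, polyC1) -/ga -/de'; ring.
  by rewrite mulf_eq0 expf_eq0 (negPf X0) addr_eq0 -polyCN => /eqP.
have BE : B = (- (2 * gamma * dl))%:P by rewrite (comp_polyNX B'E) comp_polyC.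
have [A1 A2] := evl (gamma ^+ 2); rewrite -AE in A1 A2.
have [B1 B2] : (ev B)`_1 = 0 /\ (ev B)`_2 = 0 by rewrite BE; apply: evc.
rewrite A1 A2 B1 B2 in E1 E2.
(* Order s^5 of the X^1 equation, where t^2 A(- t) meets 2 gamma t^2 c(- t). *)
have C'E : 2 * C' = gamma%:P * 'X.
  have : gamma%:P * 'X ^+ 2 * (2 * C' - gamma%:P * 'X) = 0.
    apply: (@low_coef D 5 _ (t ^+ 3 * s * B'%:P + t ^+ 2 * s ^+ 2 * h0 + s * t * h1
      + 2 * ga * t * s * g1 + 2 * (de' * t * s + s ^+ 2 * g0) * (t * C'%:P + s ^+ 2 * g1))).
    rewrite -[RHS]E1 A'E !(polyCN, polyC_exp, polyCM, polyCD, polyC1) -/ga -/de'.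
    by ring.
  move=> /eqP; rewrite !mulf_eq0 !(negPf X0) polyC_eq0 (negPf gamma0) /=.
  by rewrite subr_eq0 => /eqP.
have two : (2 : D) = (2 : F)%:P by rewrite polyC_natr.
have C'E2 : C' = (gamma / 2)%:P * 'X.
  apply: (mulfI (x := 2)); first by rewrite two polyC_eq0.
  by rewrite C'E mulrA two -polyCM mulrCA mulfV // mulr1.
have cE : c = (- (gamma / 2))%:P * 'X.
  by rewrite (comp_polyNX C'E2) rmorphM /= comp_polyC comp_polyX polyCN mulrN mulNr.
have [C1 _] := evl (- (gamma / 2)); rewrite -cE in C1.
move/eqP: E2; rewrite C1 -subr_eq0 => /eqP E2.
(* Order s^4 of the X^2 equation; it must cancel before order s^6 can be read. *)
have ga2 : gamma ^+ 2 = gamma.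
  have /eqP : 'X ^+ 2 * (gamma ^+ 2 - gamma)%:P = 0 :> D.
    apply: (@low_coef D 4 _ (s * (t ^+ 2 * C'%:P ^+ 2 - t ^+ 2 * de') + s ^+ 2 * (t * h2
      + t ^+ 2 * s * h1 + 2 * (ga * t + de' * t * s ^+ 2 + s ^+ 3 * g0) * g2
      + s * (2 * t * C'%:P * g1 + s ^+ 2 * g1 ^+ 2) - t * g0))).
    by rewrite -[RHS]E2 !(polyCN, polyC_exp, polyCM, polyCD) -/ga -/de'; ring.
  by rewrite mulf_eq0 expf_eq0 (negPf X0) polyC_eq0 subr_eq0 => /eqP.
(* Order s^6 says c(- t)^2 = d. The left side is (gamma t / 2)^2, so its t^2 coefficient is nonzero,
   while d is constant. *)
have /eqP : 'X ^+ 2 * (C' ^+ 2 - dl%:P) = 0.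
  apply: (@low_coef D 6 _ (t * h2
      + t ^+ 2 * s * h1 + 2 * (ga * t + de' * t * s ^+ 2 + s ^+ 3 * g0) * g2
      + s * (2 * t * C'%:P * g1 + s ^+ 2 * g1 ^+ 2) - t * g0)).
  by rewrite -[RHS]E2 ga2 !(polyCN, polyC_exp, polyCM, polyCD) -/ga -/de'; ring.
rewrite mulf_eq0 expf_eq0 (negPf X0) subr_eq0 => /eqP.
rewrite C'E2 exprMn -polyC_exp => /(congr1 (fun p : D => p`_2)).
rewrite coefCM coefXn coefC /= mulr1 => /eqP.
by rewrite expf_eq0 mulf_eq0 invr_eq0 (negPf gamma0) (negPf two_neq0).
Qed.

End Core.

(** * From the identities at points to the theorem over [R[i]] *)

Theorem theorem6 (R : realType) :
  ~ exists phi : GA 3 (laurent R[i]),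
      (GApoly R[i] 3 `&` pullbackGApoly (psi R[i])) phi /\
      ga_act phi var_y =
        map_mpoly (@poly_laurent R[i]) (poly_b1 ('X : {poly R[i]})).
Proof.
move=> [phi [phiI phiy]].
have [G [H [G' [H' pts]]]] := point_equations phiI phiy.
have [a [b [c [d [e G_exp]]]]] := point_eval_weighted_expansion G.
have [A [B [c' [d' [e' H_exp]]]]] := point_eval_weighted_expansion H.
have theta_pts (S : comNzRingType) k (x y z u : S) := (pts S k x y z u).1.
have phi_pts (S : comNzRingType) k (x y z u : S) := (pts S k x y z u).2.
have two : 2 != 0 :> R[i] by rewrite Num.Theory.pnatr_eq0.
apply: (point_equations_absurd theta_pts phi_pts two G_exp (A := A) (B := B)).
(* For [H] only the coefficients of 1 and z are kept; the other terms are absorbed into multiples of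
   x, y and z^2. *)
move=> S k x y z u ev; have [P1 [P2 [P3 [P4 [P5 [P6 E]]]]]] := H_exp S k x y z u.
exists (ev c' + z * P2 + x * P3 + y * P5), (ev d' + z * P4 + y * P6).
exists (ev e' + z * P1).
rewrite E -!/(ev _); move: (ev A) (ev B) (ev c') (ev d') (ev e') => ? ? ? ? ?.
by ring.
Qed.
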